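(* Let $\alpha \in [0,1]$ and let $G$ be a simple graph with $m \neq 0$ edges, $n \geq 3$ vertices, maximum degree $\Delta$ and minimum degree $\delta$. Then $$\lambda_1(A_\alpha(G)) \geq \alpha\,\frac{(\Delta^2+\delta^2)(n-2) + (2m-\Delta-\delta)^2}{2m(n-2)} + (1-\alpha)\,\frac{8m^3}{n^2\big(2\delta m + (n-1)(2m-n\delta)\big)}.$$ Equality occurs if $G$ is a regular graph.
   Context: For a simple graph $G$ with adjacency matrix $A(G)$ and diagonal degree matrix $D(G)$, and $\alpha\in[0,1]$, $A_\alpha(G)=\alpha D(G)+(1-\alpha)A(G)$, and $\lambda_1(A_\alpha(G))$ is its largest eigenvalue. *)

(* Defs.v *)
From mathcomp Require Import all_boot all_order all_algebra.
From mathcomp Require Import polyrcf complex.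
Set Implicit Arguments.
Unset Strict Implicit.
Unset Printing Implicit Defensive.
Import Order.TTheory GRing.Theory Num.Theory.
Local Open Scope ring_scope.

Section Graph.
Variables (T : finType) (e : rel T).

Definition edges : {set {set T}} :=
  [set [set p.1; p.2] | p : T * T & e p.1 p.2].

Definition degree (x : T) : nat := #|[set y | e x y]|.

Definition max_degree : nat := \max_(x : T) degree x.

(* The default #|T| bounds every degree, so for nonempty T this is the true
   minimum. *)
Definition min_degree : nat := \big[minn/#|T|]_(x : T) degree x.

Definition regular : Prop := exists k : nat, forall x, degree x = k.

Variable R : pzRingType.

Definition adjacency_mx : 'M[R]_#|T| :=
  \matrix_(i, j) (e (enum_val i) (enum_val j))%:R.

Definition degree_mx : 'M[R]_#|T| :=
  diag_mx (\row_i (degree (enum_val i))%:R).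

Definition A_alpha (alpha : R) : 'M[R]_#|T| :=
  alpha *: degree_mx + (1 - alpha) *: adjacency_mx.

End Graph.

Section LargestEigenvalue.
Variable R : rcfType.

(* The maximum of the roots in R of the characteristic polynomial; it is 0 when
   there are none, which does not happen for a nonempty symmetric matrix, see
   [lambda1_eigenvalue]. *)
Definition lambda1 n (A : 'M[R]_n) : R :=
  let s := rootsR (char_poly A) in \big[Num.max/head 0 s]_(x <- s) x.

Lemma mem_rootsR_char n (A : 'M[R]_n) a :
  (a \in rootsR (char_poly A)) = eigenvalue A a.
Proof.
have p0 : char_poly A != 0 by rewrite monic_neq0 ?char_poly_monic.
by rewrite eigenvalue_root_char -(roots_on_rootsR p0) in_itv.
Qed.

Lemma lambda1_max n (A : 'M[R]_n) a : eigenvalue A a -> a <= lambda1 A.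
Proof.
rewrite -mem_rootsR_char /lambda1; move: (head 0 _) => d.
elim: (rootsR _) => //= b s IH; rewrite inE big_cons le_max.
by case/predU1P=> [->|/IH->]; rewrite ?lexx ?orbT.
Qed.

Lemma sym_eigenvalue_ex n (A : 'M[R]_n.+1) :
  A^T = A -> exists a, eigenvalue A a.
Proof.
move=> Asym; pose f := real_complex R; pose B := map_mx f A.
have [z zB] : exists z, eigenvalue B z.
  have /closed_rootP[z rz] : size (char_poly B) != 1 by rewrite size_char_poly.
  by exists z; rewrite eigenvalue_root_char.
have /eigenvalueP[v vB v0] := zB.
pose w := map_mx Num.conj v^T.
have Bw : B *m w = z^* *: w.
  have BE : B = map_mx Num.conj B^T.
    apply/matrixP=> i j; rewrite !mxE -[in LHS]Asym mxE.
    by rewrite conj_Creal // complex_real.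
  by rewrite BE -map_mxM -trmx_mul vB linearZ /= map_mxZ.
have vw0 : v *m w != 0.
  apply: contra v0 => /eqP /matrixP /(_ 0 0); rewrite !mxE.
  under eq_bigr do rewrite !mxE -normCK.
  move/eqP; rewrite psumr_eq0 => [/allP h|i _]; last exact: exprn_ge0.
  apply/eqP/matrixP=> i j; rewrite (ord1 i) mxE.
  by have /implyP/(_ isT) := h j (mem_index_enum j); rewrite expf_eq0 /= normr_eq0 => /eqP.
have zr : z \is Num.real.
  apply/CrealP.
  have : v *m B *m w = v *m (B *m w) by rewrite mulmxA.
  rewrite vB Bw -scalemxAl -scalemxAr => /eqP.
  by rewrite -subr_eq0 -scalerBl scaler_eq0 (negPf vw0) orbF subr_eq0 eq_sym => /eqP.
exists (complex.Re z); rewrite eigenvalue_root_char.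
move: zB; rewrite eigenvalue_root_char -map_char_poly.
by rewrite -(RRe_real zr) fmorph_root.
Qed.

Lemma lambda1_eigenvalue n (A : 'M[R]_n) :
  (0 < n)%N -> A^T = A -> eigenvalue A (lambda1 A).
Proof.
case: n A => // n A _ /sym_eigenvalue_ex[a].
rewrite -!mem_rootsR_char /lambda1.
case: (rootsR _) => //= b s _; set t := b :: s.
rewrite big_seq; elim/big_ind: _ => [|x y xt yt|x //]; first exact: mem_head.
by rewrite maxEle; case: ifP.
Qed.

End LargestEigenvalue.

(* Main.v *)
(** Take the Rayleigh quotient of [A_alpha] at the vector [x u = sqrt (d u)], of
    squared norm [2 m].  The diagonal part contributes [\sum_u d u ^+ 2], bounded
    below by isolating a vertex of maximum and one of minimum degree and applying
    Cauchy-Schwarz to the others.  The adjacency part is the sum of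
    [sqrt (d u * d v)] over ordered edges; it is at least [(2 m)^2 / n] because
    the Randic index [\sum_(uv edge) 1 / sqrt (d u * d v)] is at most [n / 2].
    Finally [2 m / n] dominates the second term of the bound, whose factor
    [2 delta m + (n - 1) (2 m - n delta)] is an upper bound of [\sum_u d u ^+ 2],
    which is itself at least [(2 m)^2 / n].  For a [k]-regular graph the bound is
    [k], and no eigenvalue exceeds the maximum degree. *)
Require Import Defs.
From mathcomp Require Import all_boot all_order all_algebra.
From mathcomp Require Import complex spectral ring lra zify.
Import Order.TTheory GRing.Theory Num.Theory.
Local Open Scope ring_scope.
Local Open Scope sesquilinear_scope.

(** * Rayleigh quotients and the spectral theorem *)

(** Over the complex extension of [R], [A] is unitarily diagonalisable with real spectrum. In an
    eigenbasis the form is a sum of eigenvalues weighted by squared moduli, and each of these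
    eigenvalues is already one of [A] over [R]. *)
Lemma rayleigh_le_lambda1 (R : rcfType) n (A : 'M[R]_n) (x : 'rV[R]_n) :
  A^T = A -> (x *m A *m x^T) 0 0 <= lambda1 A * (x *m x^T) 0 0.
Proof.
move=> Asym; pose f := real_complex R; pose B := map_mx f A.
have Breal : B \is a realmx.
  by apply/mxOverP=> i j; rewrite mxE complex_real.
have Bherm : B \is hermsymmx.
  apply/realsym_hermsym => //; apply/is_hermitianmxP.
  by rewrite expr0 scale1r map_mx_id // /B map_trmx Asym.
have BE := orthomx_spectralP (hermitian_normalmx Bherm).
have spR := hermitian_spectral_diag_real Bherm.
have PU := spectral_unitarymx B.
move: BE spR PU; set P := spectralmx B; set sp := spectral_diag B => BE spR PU.
have Pu : P \in unitmx := unitarymx_unit PU.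
have sp_real j : sp 0 j = f (complex.Re (sp 0 j)).
  by rewrite /f RRe_real //; apply/(mxOverP spR).
have sp_le j : complex.Re (sp 0 j) <= lambda1 A.
  apply: lambda1_max; suff : eigenvalue B (sp 0 j).
    by rewrite sp_real !eigenvalue_root_char -map_char_poly fmorph_root.
  (* Since [B] is [invmx P *m diag_mx sp *m P], the rows of [P] are left eigenvectors; they are
     nonzero because [P] is invertible. *)
  apply/eigenvalueP; exists (row j P); last first.
    apply: contraL Pu => /eqP Pj0; rewrite -row_free_unit.
    by apply/negP=> /row_freeP[Q /(congr1 (row j))]; rewrite row_mul Pj0 mul0mx
       => /rowP/(_ j) /eqP; rewrite !mxE eqxx eq_sym oner_eq0.
  rewrite -row_mul -/B {1}BE !mulmxA mulmxV // mul1mx.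
  by rewrite row_mul row_diag_mx -scalemxAl -rowE.
pose X := map_mx f x; pose y := X *m P^t*.
have XtE : map_mx f x^T = X^t*.
  by apply/matrixP=> i j; rewrite !mxE conj_Creal ?complex_real.
have ytE : y^t* = P *m X^t*.
  by rewrite /y trmx_mul map_mxM trmxCK.
have E1 : f ((x *m x^T) 0 0) = \sum_j `|y 0 j| ^+ 2.
  have -> : f ((x *m x^T) 0 0) = (y *m y^t*) 0 0.
    rewrite ytE /y mulmxA -[X *m _ *m P]mulmxA -(invmx_unitary PU) mulVmx //.
    by rewrite mulmx1 -XtE -map_mxM [RHS]mxE.
  by rewrite mxE; apply: eq_bigr => j _; rewrite !mxE -normCK.
have E2 : f ((x *m A *m x^T) 0 0) = \sum_j sp 0 j * `|y 0 j| ^+ 2.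
  have -> : f ((x *m A *m x^T) 0 0) = (y *m diag_mx sp *m y^t*) 0 0.
    rewrite ytE /y -(invmx_unitary PU) !mulmxA.
    rewrite -[X *m _ *m _]mulmxA -[X *m _ *m _]mulmxA -BE.
    by rewrite -XtE -!map_mxM [RHS]mxE.
  rewrite mul_mx_diag mxE; apply: eq_bigr => j _; rewrite !mxE.
  by rewrite mulrAC mulrC -normCK.
suff : f ((x *m A *m x^T) 0 0) <= f (lambda1 A) * f ((x *m x^T) 0 0).
  by rewrite -rmorphM lecR.
rewrite E1 E2 mulr_sumr; apply: ler_sum => j _.
by rewrite sp_real ler_wpM2r ?exprn_ge0 // lecR.
Qed.

(** * Edge counting and extremal degrees *)

(** Both sides count the adjacent ordered pairs: the fibre of [f] over an edge consists of [(a, b)]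
    and [(b, a)], distinct because there are no loops. *)
Lemma sum_degree (T : finType) (e : rel T) :
  symmetric e -> irreflexive e -> (\sum_x degree e x = 2 * #|edges e|)%N.
Proof.
move=> e_sym e_irr; pose D := [set p : T * T | e p.1 p.2].
transitivity #|D|.
  rewrite -sum1_card (eq_bigl (fun p => e p.1 p.2)) => [|p]; last by rewrite inE.
  rewrite -(pair_big_dep xpredT e (fun _ _ => 1%N)) /=.
  by apply: eq_bigr => x _; rewrite sum1dep_card.
pose f (p : T * T) := [set p.1; p.2].
have -> : edges e = f @: D.
  by apply/setP=> E; apply/imsetP/imsetP=> -[p pD ->]; exists p; rewrite // inE in pD *.
rewrite -sum1_card (partition_big_imset f) /= mulnC -sum_nat_const.
apply: eq_bigr => _ /imsetP[[a b] /[!inE] /= eab ->].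
have neq_ab : a != b by apply: contraTneq eab => ->; rewrite e_irr.
rewrite sum1dep_card -(_ : #|[set (a, b); (b, a)]| = 2%N); last first.
  by rewrite cards2 xpair_eqE (negPf neq_ab).
apply: eq_card => -[c d]; rewrite !inE /= !xpair_eqE /f /=.
apply/andP/orP=> [[ecd /eqP E]|[]/andP[/eqP-> /eqP->]]; last 2 first.
- by rewrite eab.
- by rewrite e_sym eab setUC.
have neq_cd : c != d by apply: contraTneq ecd => ->; rewrite e_irr.
have /setP/(_ c) := E; have /setP/(_ d) := E; rewrite !inE !eqxx orbT /=.
move=> /esym/orP[]/eqP dE /esym/orP[]/eqP cE; move: neq_cd;
  by rewrite dE cE !eqxx //=; auto.
Qed.

Lemma min_degree_le {T : finType} (e : rel T) x : (min_degree e <= degree e x)%N.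
Proof.
rewrite /min_degree; have : x \in index_enum T by rewrite mem_index_enum.
elim: (index_enum T) => //= y s IH; rewrite inE big_cons geq_min.
by case/predU1P=> [<-|/IH ->]; rewrite ?leqnn ?orbT.
Qed.

Lemma degree_le_max {T : finType} (e : rel T) x : (degree e x <= max_degree e)%N.
Proof. exact: leq_bigmax. Qed.

Lemma degree_lt_card (T : finType) (e : rel T) x :
  irreflexive e -> (degree e x < #|T|)%N.
Proof.
move=> e_irr; rewrite /degree -cardsT; apply: proper_card.
by apply/properP; split; [exact: subsetT | exists x; rewrite !inE ?e_irr].
Qed.

(** The iterated minimum is either some degree or its default [#|T|]; without loops every degree is
    below [#|T|], which excludes the default. *)
Lemma min_degree_attained (T : finType) (e : rel T) :
  irreflexive e -> (0 < #|T|)%N -> exists x, degree e x = min_degree e.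
Proof.
move=> e_irr /card_gt0P[x0 _].
have : (exists x, degree e x = min_degree e) \/ min_degree e = #|T|.
  rewrite /min_degree; elim/big_rec: _ => [|x m _ IH]; first by right.
  by case: (leqP (degree e x) m) => h; [left; exists x|].
case=> // minT; have := min_degree_le e x0.
by rewrite minT leqNgt degree_lt_card.
Qed.

Lemma max_degree_attained (T : finType) (e : rel T) :
  (0 < #|T|)%N -> exists x, degree e x = max_degree e.
Proof.
by move=> T0; have [x mE] := bigop.eq_bigmax (degree e) T0; exists x.
Qed.

(** If the two vertices found coincide, all degrees are equal, and any other vertex can replace
    [x]. *)
Lemma extremal_vertices (T : finType) (e : rel T) :
  irreflexive e -> (1 < #|T|)%N ->
  exists x y, [/\ x != y, degree e x = max_degree e & degree e y = min_degree e].
Proof.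
move=> e_irr T1; have T0 := ltnW T1.
have [x xE] := max_degree_attained _ e T0.
have [y yE] := min_degree_attained _ e e_irr T0.
case: (eqVneq x y) => [xy|]; last by exists x, y.
have /card_gt0P[z] : (0 < #|[set~ x]|)%N by rewrite cardsC1; lia.
rewrite !inE => zx; exists z, x; split=> //; last by rewrite xy.
by have := min_degree_le e z; have := degree_le_max e z; rewrite -xE -yE xy; lia.
Qed.

(* Cauchy-Schwarz against the constant function, obtained from
   [0 <= \sum_i (a i - c) ^+ 2] with [c] the mean of [a]. *)
Lemma sqr_sum_le (R : realFieldType) (I : finType) (P : {set I}) (a : I -> R) :
  (\sum_(i in P) a i) ^+ 2 <= #|P|%:R * \sum_(i in P) a i ^+ 2.
Proof.
have [/eqP|P0] := posnP #|P|.
  by rewrite cards_eq0 => /eqP->; rewrite !big_set0 expr0n /= mulr0.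
set S := \sum_(i in P) a i; set Q := \sum_(i in P) _; set N : R := #|P|%:R.
have N0 : 0 < N by rewrite ltr0n.
have : 0 <= \sum_(i in P) (N * a i - S) ^+ 2 by apply: sumr_ge0 => i _; exact: sqr_ge0.
have -> : \sum_(i in P) (N * a i - S) ^+ 2 = N * (N * Q - S ^+ 2).
  have sqrE i : (N * a i - S) ^+ 2 =
      N ^+ 2 * a i ^+ 2 + (- (2 * N * S) * a i + S ^+ 2) by ring.
  under eq_bigr do rewrite sqrE.
  by rewrite !big_split /= -!mulr_sumr -/S -/Q sumr_const -mulr_natl -/N; ring.
by rewrite pmulr_rge0 // subr_ge0.
Qed.

(** * The quadratic form of [A_alpha] and sums over ordered edges *)

Section QuadraticForm.
Variables (R : rcfType) (T : finType) (e : rel T).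
Hypothesis e_sym : symmetric e.

Lemma sum_enum_val (F : T -> R) : \sum_(i < #|T|) F (enum_val i) = \sum_u F u.
Proof. by rewrite [RHS](reindex _ (onW_bij _ (@enum_val_bij T))). Qed.

Lemma trmx_A_alpha (alpha : R) : (A_alpha e alpha)^T = A_alpha e alpha.
Proof.
rewrite /A_alpha linearD /= !linearZ /= /degree_mx tr_diag_mx.
by congr (_ + _ *: _); apply/matrixP=> i j; rewrite !mxE e_sym.
Qed.

Lemma row_sqr_norm (g : T -> R) (x := \row_(i < #|T|) g (enum_val i)) :
  (x *m x^T) 0 0 = \sum_u g u ^+ 2.
Proof.
rewrite mxE -(sum_enum_val (fun u => g u ^+ 2)).
by apply: eq_bigr => i _; rewrite !mxE expr2.
Qed.

Lemma A_alpha_quadratic_form (alpha : R) (g : T -> R)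
    (x := \row_(i < #|T|) g (enum_val i)) :
  (x *m A_alpha e alpha *m x^T) 0 0 =
  alpha * (\sum_u (degree e u)%:R * g u ^+ 2)
  + (1 - alpha) * (\sum_u \sum_(v | e u v) g u * g v).
Proof.
rewrite /A_alpha mulmxDr mulmxDl -!scalemxAr -!scalemxAl.
rewrite mxE [in LHS]mxE [X in _ + X]mxE; congr (_ * _ + _ * _).
  rewrite /degree_mx mul_mx_diag mxE.
  rewrite -(sum_enum_val (fun u => (degree e u)%:R * g u ^+ 2)).
  by apply: eq_bigr => i _; rewrite !mxE expr2 mulrA [g _ * _]mulrC.
under [RHS]eq_bigr do rewrite big_mkcond.
rewrite exchange_big mxE -(sum_enum_val (fun v => \sum_u if e u v then _ else _)).
apply: eq_bigr => j _; rewrite !mxE mulr_suml.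
rewrite -(sum_enum_val (fun u => if e u _ then _ else _)).
apply: eq_bigr => i _; rewrite !mxE.
by case: (e _ _); rewrite ?mulr1 ?mulr0 ?mul0r.
Qed.

Lemma sum_edges_left (w : T -> R) :
  \sum_u \sum_(v | e u v) w u = \sum_u (degree e u)%:R * w u.
Proof.
by apply: eq_bigr => u _; rewrite sumr_const mulr_natl /degree cardsE.
Qed.

Lemma sum_edges_right (w : T -> R) :
  \sum_u \sum_(v | e u v) w v = \sum_u (degree e u)%:R * w u.
Proof.
rewrite (exchange_big_dep xpredT) //= -sum_edges_left.
by apply: eq_bigr => u _; apply: eq_bigl => v; rewrite e_sym.
Qed.

Lemma sum_edges_affine (a b : R) (w : T -> R) :
  \sum_u \sum_(v | e u v) (a - b * (w u + w v)) =
  a * (\sum_u (degree e u)%:R) - b * ((\sum_u (degree e u)%:R * w u) *+ 2).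
Proof.
under eq_bigr do rewrite sumrB -mulr_sumr big_split /=.
rewrite sumrB (sum_edges_left (fun=> a)) -mulr_suml -mulr_sumr big_split /=.
by rewrite sum_edges_left sum_edges_right mulrC mulr2n.
Qed.

(** Evaluate the form at an eigenvector [g]. Summing [2 * g u * g w <= g u ^+ 2 + g w ^+ 2] over
    edges bounds the adjacency form by the degree form, so [alpha] drops out. This settles the
    regular case. *)
Lemma lambda1_A_alpha_le (alpha : R) : (0 < #|T|)%N -> alpha <= 1 ->
  lambda1 (A_alpha e alpha) <= (max_degree e)%:R.
Proof.
move=> T0 alpha_le1.
have /eigenvalueP[v vA v0] := lambda1_eigenvalue T0 (trmx_A_alpha alpha).
set a := lambda1 _ in vA *; pose g u := v 0 (enum_rank u).
have vE : v = \row_i g (enum_val i).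
  by apply/rowP=> i; rewrite mxE /g enum_valK.
have := A_alpha_quadratic_form alpha g; have := row_sqr_norm g.
rewrite /= -vE vA -scalemxAl [X in _ -> X = _ -> _]mxE => -> Q.
have g0 : 0 < \sum_u g u ^+ 2.
  rewrite lt_neqAle eq_sym sumr_ge0 ?andbT => [|u _]; last exact: sqr_ge0.
  apply: contra v0; rewrite psumr_eq0 => [/allP g0|u _]; last exact: sqr_ge0.
  apply/eqP/rowP=> i; rewrite [RHS]mxE vE mxE.
  by have /implyP/(_ isT) := g0 _ (mem_index_enum (enum_val i));
    rewrite sqrf_eq0 => /eqP.
have le_edges : \sum_u \sum_(w | e u w) g u * g w <=
    \sum_u (degree e u)%:R * g u ^+ 2.
  have : \sum_u \sum_(w | e u w) g u * g w <=
      2^-1 * (\sum_u \sum_(w | e u w) g u ^+ 2 + \sum_u \sum_(w | e u w) g w ^+ 2).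
    rewrite -big_split mulr_sumr; apply: ler_sum => u _ /=.
    rewrite -big_split mulr_sumr; apply: ler_sum => w _ /=.
    by have := sqr_ge0 (g u - g w); nra.
  rewrite sum_edges_left (sum_edges_right (fun u => g u ^+ 2)); lra.
have le_max : \sum_u (degree e u)%:R * g u ^+ 2 <=
    (max_degree e)%:R * \sum_u g u ^+ 2.
  rewrite mulr_sumr; apply: ler_sum => u _.
  by rewrite ler_wpM2r ?sqr_ge0 // ler_nat degree_le_max.
rewrite -(ler_pM2r g0) Q; apply: le_trans le_max.
have alphaC_ge0 : 0 <= 1 - alpha by lra.
by have := ler_wpM2l alphaC_ge0 le_edges; lra.
Qed.

(* AM-GM bounds the reciprocal edge weights by [(1 / d u + 1 / d v) / 2], whose
   sum over all ordered edges is at most [#|T|]; the tangent line of [s |-> 1 / s]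
   at the mean degree then replaces the arithmetic-harmonic mean inequality. *)
Lemma sqr_sum_degree_le (d := fun u => (degree e u)%:R : R) :
  (\sum_u d u) ^+ 2 <=
  #|T|%:R * \sum_u \sum_(v | e u v) Num.sqrt (d u) * Num.sqrt (d v).
Proof.
have [T0|T_gt0] := posnP #|T|.
  have dT0 u : d u = 0 by have := card0_eq T0 u; rewrite inE.
  by rewrite big1 // T0 mul0r expr0n.
set S := \sum_u d u; set Q := \sum_u _; set n : R := #|T|%:R.
have n0 : 0 < n by rewrite ltr0n.
have dge0 u : 0 <= d u by rewrite ler0n.
have edge_le u v : e u v -> 2 * n * S - S ^+ 2 / 2 * ((d u)^-1 + (d v)^-1) <=
    n ^+ 2 * (Num.sqrt (d u) * Num.sqrt (d v)).
  move=> euv.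
  have d0 a b : e a b -> 0 < d a.
    by move=> eab; rewrite ltr0n card_gt0; apply/set0Pn; exists b; rewrite inE.
  have du0 := d0 u v euv; have dv0 : 0 < d v by apply: (d0 v u); rewrite e_sym.
  have su0 : 0 < Num.sqrt (d u) by rewrite sqrtr_gt0.
  have sv0 : 0 < Num.sqrt (d v) by rewrite sqrtr_gt0.
  rewrite -[X in X^-1 + _](sqr_sqrtr (dge0 u)) -[X in _ + X^-1](sqr_sqrtr (dge0 v)).
  move: su0 sv0; set s := Num.sqrt _; set t := Num.sqrt _ => su0 sv0.
  rewrite -subr_ge0.
  (* The first square is the tangent-line gap, zero at [s * t = S / n]; the second is the AM-GM
     gap. *)
  have -> : n ^+ 2 * (s * t) - (2 * n * S - S ^+ 2 / 2 * ((s ^+ 2)^-1 + (t ^+ 2)^-1))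
    = (n * (s * t) - S) ^+ 2 / (s * t) + S ^+ 2 / 2 * (s^-1 - t^-1) ^+ 2.
    by field; rewrite !gt_eqF.
  have st0 : 0 <= s * t by rewrite mulr_ge0 // ltW.
  apply: addr_ge0; first by rewrite divr_ge0 // sqr_ge0.
  by apply: mulr_ge0; [rewrite divr_ge0 // sqr_ge0 | exact: sqr_ge0].
(* Only an inequality: an isolated vertex contributes 0, as [0^-1 = 0]. *)
have sumV : \sum_u d u * (d u)^-1 <= n.
  rewrite /n -sum1_card natr_sum; apply: ler_sum => u _.
  by have [->|du] := eqVneq (d u) 0; rewrite ?mul0r // divff.
have : \sum_u \sum_(v | e u v) (2 * n * S - S ^+ 2 / 2 * ((d u)^-1 + (d v)^-1))
    <= n ^+ 2 * Q.
  rewrite [leRHS]mulr_sumr; apply: ler_sum => u _.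
  by rewrite [leRHS]mulr_sumr; apply: ler_sum => v /edge_le.
have -> : \sum_u \sum_(v | e u v) (2 * n * S - S ^+ 2 / 2 * ((d u)^-1 + (d v)^-1))
    = 2 * n * S ^+ 2 - S ^+ 2 * \sum_u d u * (d u)^-1.
  by rewrite sum_edges_affine -/S; field.
have := ler_wpM2l (sqr_ge0 S) sumV => h1 h2.
by rewrite -(ler_pM2l n0); lra.
Qed.

End QuadraticForm.

(** * Bounds on the sum of squared degrees *)

Section DegreeSums.
Variables (R : realFieldType) (T : finType) (e : rel T).
Hypothesis e_irr : irreflexive e.
Let d (u : T) : R := (degree e u)%:R.
Let n : R := #|T|%:R.
Let Delta : R := (max_degree e)%:R.
Let delta : R := (min_degree e)%:R.

(** The extremal vertices are distinct, so Cauchy-Schwarz runs over exactly [n - 2] others. *)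
Lemma sum_sqr_degree_ge : (2 < #|T|)%N ->
  (Delta ^+ 2 + delta ^+ 2) * (n - 2) + (\sum_u d u - Delta - delta) ^+ 2
  <= (n - 2) * \sum_u d u ^+ 2.
Proof.
move=> T2; have [x [y [xy xE yE]]] := extremal_vertices _ e e_irr (ltnW T2).
pose P := [set~ x] :\ y.
have sumP (F : T -> R) : \sum_u F u = F x + (F y + \sum_(u in P) F u).
  rewrite (bigD1 x) //= (bigD1 y) ?[y == x]eq_sym //=; congr (_ + (_ + _)).
  by apply: eq_bigl => u; rewrite !inE andbC.
have := sqr_sum_le R T P d.
have -> : #|P|%:R = n - 2 :> R.
  have := cardsD1 y [set~ x]; rewrite cardsC1 !inE eq_sym xy /= -/P => cP.
  by rewrite /n -[in RHS](ltn_predK T2) cP -natr1 natrD; lra.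
by rewrite !sumP /d xE yE -/Delta -/delta; lra.
Qed.

(* Each term of [\sum_u (d u - delta) * (d u - (n - 1))] is nonpositive. *)
Lemma sum_sqr_degree_le :
  \sum_u d u ^+ 2 <=
  delta * \sum_u d u + (n - 1) * (\sum_u d u - n * delta).
Proof.
have sumn : n * delta = \sum_(u : T) delta by rewrite sumr_const -mulr_natl.
rewrite mulrBr sumn !mulr_sumr -sumrB -big_split; apply: ler_sum => u _ /=.
have lo : delta <= d u by rewrite ler_nat min_degree_le.
have hi : d u + 1 <= n by rewrite natr1 ler_nat degree_lt_card.
by have := mulr_ge0 (_ : 0 <= d u - delta) (_ : 0 <= n - 1 - d u); nra.
Qed.

End DegreeSums.

Theorem theorem10 (R : rcfType) (T : finType) (e : rel T) (alpha : R)
    (e_sym : symmetric e) (e_irrefl : irreflexive e)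
    (m_neq0 : #|edges e| <> 0%N) (n_ge3 : (3 <= #|T|)%N)
    (alpha_ge0 : 0 <= alpha) (alpha_le1 : alpha <= 1) :
  let m : R := #|edges e|%:R in
  let n : R := #|T|%:R in
  let Delta : R := (max_degree e)%:R in
  let delta : R := (min_degree e)%:R in
  let bound : R :=
    alpha * (((Delta ^+ 2 + delta ^+ 2) * (n - 2) + (2 * m - Delta - delta) ^+ 2)
             / (2 * m * (n - 2)))
    + (1 - alpha) * ((8 * m ^+ 3)
             / (n ^+ 2 * (2 * delta * m + (n - 1) * (2 * m - n * delta)))) in
  bound <= lambda1 (A_alpha e alpha)
  /\ (regular e -> lambda1 (A_alpha e alpha) = bound).
Proof.
move=> m n Delta delta bound.
have T0 : (0 < #|T|)%N by apply: leq_trans n_ge3.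
have n3 : 3 <= n by rewrite ler_nat.
have m0 : 0 < m by rewrite ltr0n lt0n; apply/eqP.
pose d u : R := (degree e u)%:R.
have sumd : \sum_u d u = 2 * m by rewrite -natr_sum sum_degree // natrM.
set Q := 2 * delta * m + _ in bound *.
have sqr_le : \sum_u d u ^+ 2 <= Q.
  by have := sum_sqr_degree_le R T e e_irrefl; rewrite sumd /Q; lra.
have sqr_ge := sum_sqr_degree_ge R T e e_irrefl n_ge3.
rewrite sumd -/Delta -/delta -/n in sqr_ge.
(* Cauchy-Schwarz over all vertices; it also makes the denominator containing [Q] positive. *)
have mQ : 4 * m ^+ 2 <= n * Q.
  have := sqr_sum_le R T [set: T] d; rewrite cardsT -/n.
  under eq_bigl do rewrite inE; under [X in _ * X]eq_bigl do rewrite inE.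
  rewrite sumd => h; have := ler_wpM2l (_ : 0 <= n) sqr_le; nra.
have Q0 : 0 < Q.
  by rewrite -(pmulr_rgt0 _ (_ : 0 < n)); [nra | lra].
have bound_le : bound <= lambda1 (A_alpha e alpha).
  pose g u := Num.sqrt (d u).
  have gg u : g u ^+ 2 = d u by rewrite sqr_sqrtr ?ler0n.
  have := rayleigh_le_lambda1 _ _ (A_alpha e alpha)
    (\row_i g (enum_val i)) (trmx_A_alpha _ _ _ e_sym alpha).
  rewrite row_sqr_norm A_alpha_quadratic_form.
  rewrite (eq_bigr _ (fun u _ => gg u)) sumd.
  have -> : \sum_u (degree e u)%:R * g u ^+ 2 = \sum_u d u ^+ 2.
    by apply: eq_bigr => u _; rewrite gg expr2.
  set E := \sum_u \sum_(v | _) _ => ray.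
  have hE : (2 * m) ^+ 2 <= n * E.
    by have := sqr_sum_degree_le R T e e_sym; rewrite /= -/d sumd.
  have m2 : 0 < 2 * m by lra.
  have n0 : 0 < n by lra.
  have n2 : 0 < n - 2 by lra.
  have alphaC_ge0 : 0 <= 1 - alpha by lra.
  rewrite -(ler_pM2r m2); apply: le_trans ray; rewrite /bound mulrDl.
  rewrite -[alpha * _ * _]mulrA -[(1 - alpha) * _ * _]mulrA.
  apply: lerD; apply: ler_wpM2l => //.
    rewrite mulrAC ler_pdivrMr ?mulr_gt0 //.
    by have := ler_wpM2l (ltW m2) sqr_ge; lra.
  apply: (@le_trans _ _ ((2 * m) ^+ 2 / n)); last by rewrite ler_pdivrMr // [E * n]mulrC.
  rewrite mulrAC ler_pdivrMr ?mulr_gt0 ?exprn_gt0 //.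
  (* With denominators cleared, the claim is [mQ] multiplied by [4 * m ^+ 2]. *)
  have -> : (2 * m) ^+ 2 / n * (n ^+ 2 * Q) = 4 * m ^+ 2 * (n * Q).
    by field; rewrite gt_eqF.
  have m4 : 0 <= 4 * m ^+ 2 by rewrite mulr_ge0 ?sqr_ge0 ?ler0n.
  by have := ler_wpM2l m4 mQ; lra.
split=> // -[k dk].
have [x [y [_ xE yE]]] := extremal_vertices _ e e_irrefl (ltnW n_ge3).
have DE : Delta = k%:R by rewrite /Delta -xE dk.
have dE : delta = k%:R by rewrite /delta -yE dk.
have mE : m = n * k%:R / 2.
  have : \sum_u d u = n * k%:R.
    rewrite (eq_bigr (fun=> k%:R)) => [|u _]; last by rewrite /d dk.
    by rewrite sumr_const -[LHS]mulr_natl.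
  by rewrite sumd; lra.
have k0 : k%:R != 0 :> R.
  by apply: contraTneq m0 => k0; rewrite mE k0 mulr0 mul0r ltxx.
apply/eqP; rewrite eq_le bound_le andbT.
suff -> : bound = k%:R.
  by rewrite -DE lambda1_A_alpha_le.
(* Here [Q] becomes [n * k ^+ 2], and both fractions reduce to [k]. *)
rewrite /bound /Q DE dE mE; field.
have n0 : n != 0 by rewrite gt_eqF //; lra.
have n2 : n - 2 != 0 by rewrite gt_eqF //; lra.
by rewrite subrr mulr0 addr0 n0 n2 k0 !mulf_neq0.
Qed.
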